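(* Let $N=2^e t+1>3$, where $t$ is odd and $2^e>t>0$, and suppose that $3\nmid t$. Then $N$ is prime if and only if $$3^{(N-1)/2}\equiv -1\pmod{N}.$$
   Context: Here $e$ and $t$ are integers; numbers $N=2^e\cdot t+1$ with $t$ odd and $2^e>t>0$ are called Proth numbers. *)

(* Defs.v *)
From mathcomp Require Import all_boot all_order all_algebra.

Set Implicit Arguments.
Unset Strict Implicit.
Unset Printing Implicit Defensive.

(* Main.v *)
(** Let [w] be a primitive cube root of unity and [s = w - w^2], so that
    [s^2 = -3].  If [N] is prime, then [N = 2 mod 3] because [3] divides neither
    [N] nor [N - 1], so Frobenius sends [w] to [w^2] and [s] to [-s]; hence
    [(-3)^((N-1)/2) = s^(N-1) = -1], and the sign disappears because [4] divides
    [N - 1].  Conversely the congruence forces [3^t] to have order [2^e] modulo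
    every prime divisor [q] of [N], so [q > 2^e], which exceeds the square root
    of [N - 1], and [q^2 > N]. *)
Require Import Defs.
From mathcomp Require Import all_boot all_order all_algebra all_field.
From mathcomp Require Import zify ring.

Import GRing.Theory.
Local Open Scope ring_scope.

Lemma modz_Fp_eq (p : nat) (a b : int) : prime p ->
  (a = b %[mod (p : int)])%Z <-> a%:~R = b%:~R :> 'F_p.
Proof.
move=> p_pr; have chp : p \in [pchar 'F_p] by apply: pchar_Fp.
split=> [/eqP | /eqP ab]; last apply/eqP; rewrite ?eqz_mod_dvd.
  by rewrite (dvdz_pcharf chp) rmorphB subr_eq0 => /eqP.
by rewrite (dvdz_pcharf chp) rmorphB subr_eq0.
Qed.

Lemma expr_frobeniusN (K : fieldType) (p : nat) (w : K) :
    p \in [pchar K] -> w ^+ 2 + w + 1 = 0 -> (p %% 3 = 2)%N ->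
  (w - w ^+ 2) ^+ p = - (w - w ^+ 2).
Proof.
move=> chp w0 p3.
have w3 : w ^+ 3 = 1.
  apply: subr0_eq; transitivity ((w - 1) * (w ^+ 2 + w + 1)); first by ring.
  by rewrite w0 mulr0.
have wp : w ^+ p = w ^+ 2 by rewrite (divn_eq p 3) p3 exprD mulnC exprM w3 expr1n mul1r.
rewrite -(pFrobenius_autE chp) pFrobenius_autB_comm; last exact: mulrC.
rewrite !pFrobenius_autE exprAC wp -exprM (exprD w 3 1) w3.
by ring.
Qed.

Lemma expr_half_Nthree (p : nat) : prime p -> odd p -> (p %% 3 = 2)%N ->
  (- 3%:R : 'F_p) ^+ (p - 1)./2 = -1.
Proof.
move=> p_pr p_odd p3.
have [K [f _]] := countable_algebraic_closure 'F_p.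
have chp : p \in [pchar K] by rewrite (fmorph_pchar f) pchar_Fp.
(* With both coefficients [-1], this solves [w ^+ 2 = -1 - w]. *)
have [w] := @solve_monicpoly K 2 (fun=> -1) isT.
rewrite !big_ord_recl big_ord0 /= => wE.
have w0 : w ^+ 2 + w + 1 = 0 by rewrite wE; ring.
set s := w - w ^+ 2.
have s2 : s ^+ 2 = - 3%:R.
  apply: subr0_eq.
  transitivity ((w ^+ 2 + w + 1) * (w ^+ 2 - 3%:R * w + 3%:R)).
    by rewrite /s; ring.
  by rewrite w0 mul0r.
(* Here [p] differs from 3, so [s] can be cancelled from [s * s ^+ p.-1 = - s]. *)
have s_neq0 : s != 0.
  rewrite -sqrf_eq0 s2 oppr_eq0 -(dvdn_pcharf chp).
  by rewrite dvdn_prime2 //; apply: contraPneq p3 => ->.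
apply: (fmorph_inj f); rewrite rmorphXn !rmorphN rmorph_nat rmorph1 -s2 -exprM.
have -> : (2 * (p - 1)./2 = p.-1)%N by lia.
apply: (mulfI s_neq0); rewrite -exprS prednK ?prime_gt0 //.
by rewrite mulrN1 expr_frobeniusN.
Qed.

(** Since [-1] differs from 1 for odd [q], [x] has order exactly [2 ^ k.+1], which divides [q.-1] by
    Fermat. *)
Lemma expf2_eqN1_dvdn (q k : nat) (x : 'F_q) : prime q -> odd q ->
  x ^+ (2 ^ k) = -1 -> (2 ^ k.+1 %| q.-1)%N.
Proof.
move=> q_pr q_odd xk.
have N1_neq1 : (-1 : 'F_q) != 1.
  rewrite eq_sym -addr_eq0 -[1 + 1]/(2%:R) -(dvdn_pcharf (pchar_Fp q_pr)).
  by rewrite dvdn_prime2 //; apply: contraTneq q_odd => ->.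
have [||m m_prim] := @prim_order_exists _ (2 ^ k.+1) x.
- by rewrite expn_gt0.
- by rewrite expnSr exprM xk sqrrN expr1n.
case/(dvdn_pfactor _ _ (isT : prime 2)) => j le_jk mE.
(* If [j <= k], the order [2 ^ j] would divide [2 ^ k], giving [-1 = 1]. *)
have {le_jk} -> : k.+1 = j.
  apply/eqP; rewrite eqn_leq le_jk andbT ltnNge.
  apply: contra N1_neq1 => /(dvdn_exp2l 2).
  by rewrite -mE (prim_order_dvd m_prim) xk.
rewrite -mE (prim_order_dvd m_prim).
have x_neq0 : x != 0.
  apply: contra_eq_neq xk => ->.
  by rewrite expr0n expn_eq0 /= eq_sym oppr_eq0 oner_eq0.
apply/eqP/(mulfI x_neq0); rewrite -exprS prednK ?prime_gt0 // mulr1.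
have:= expf_card x; by rewrite card_Fp.
Qed.

Local Close Scope ring_scope.

Theorem theorem1p3 (e t N : nat)
    (hN : N = 2 ^ e * t + 1) (N_gt3 : 3 < N)
    (t_odd : odd t) (t_gt0 : 0 < t) (t_lt : t < 2 ^ e)
    (t_n3 : ~~ (3 %| t)) :
  prime N <->
  ((3 : int) ^+ ((N - 1) %/ 2)%N = -1 %[mod (N : int)])%Z.
Proof.
(* The case [e = 0] leaves no [t], and [e = 1] forces [t = 1], hence [N = 3]. *)
have [k eE] : exists k, e = k.+2.
  case: e hN t_lt => [|[|k]] hN' t_lt'; [lia | lia | by exists k].
have halfN : (N - 1) %/ 2 = t * 2 ^ k.+1 by rewrite hN eE expnS; lia.
have N_odd : odd N by rewrite hN eE expnS; lia.
split=> [N_pr | hpow].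
  apply/(modz_Fp_eq _ _ _ N_pr); rewrite rmorphXn rmorphN1 /=.
  have N3 : N %% 3 = 2.
    have n31 : ~~ (3 %| N - 1).
      by rewrite hN addnK Euclid_dvdM // Euclid_dvdX // negb_or t_n3.
    have n30 : ~~ (3 %| N) by rewrite dvdn_prime2 //; lia.
    lia.
  (* The exponent [t * 2 ^ k.+1] is even, so 3 and -3 have the same power. *)
  rewrite -(expr_half_Nthree N N_pr N_odd N3) -divn2 exprNn.
  by rewrite halfN -signr_odd expnS !oddM andbF expr0 mul1r.
have N_gt1 : 1 < N by lia.
(* It suffices that the least prime divisor of [N] has square above [N]. *)
apply: ltn_pdiv2_prime; first by lia.
set q := pdiv N; have q_pr : prime q by apply: pdiv_prime.
have q_odd : odd q by apply: dvdn_odd N_odd; apply: pdiv_dvd.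
have hq : ((3%:R ^+ t) ^+ (2 ^ k.+1) = -1 :> 'F_q)%R.
  rewrite -exprM -halfN.
  have := (modz_Fp_eq q ((3 : int) ^+ ((N - 1) %/ 2))%R (-1)%R q_pr).1.
  rewrite rmorphXn rmorphN1 /=; apply.
  apply/eqP; rewrite eqz_mod_dvd.
  apply: (@dvdz_trans N); first exact: pdiv_dvd.
  by rewrite -eqz_mod_dvd; apply/eqP.
have lt_q : 2 ^ e < q.
  have := expf2_eqN1_dvdn q k.+1 _ q_pr q_odd hq.
  by rewrite -eE => /dvdn_leq; have := prime_gt1 q_pr; lia.
(* From [t < 2 ^ e < q], [2 ^ e * t + 1 <= 2 ^ e * 2 ^ e < q ^ 2]. *)
rewrite hN; nia.
Qed.
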